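(* A pair of positive integers $(a,b)$ with $a \le b$ is a reversed sum-product pair for the base $10$ if and only if $(a,b)$ is one of $$(2,2),\ (9,9),\ (3,24),\ (2,47),\ (2,497),\ (2,4997),\ (2,49997),\ \ldots,$$ that is, if and only if $(a,b) \in \{(2,2),(9,9),(3,24)\}$ or $(a,b) = (2,\, 5\cdot 10^k - 3)$ for some integer $k \ge 1$.
   Context: A base-$\beta$ representation of a positive integer is canonical if it has no leading zero. A pair of positive integers $a \le b$ is a reversed sum-product pair for the base $\beta$ if the canonical base-$\beta$ representations of $a+b$ and $ab$ are the reverse of each other as digit strings (in particular they have the same number of digits). *)

(* Defs.v *)
From mathcomp Require Import all_boot.

Set Implicit Arguments.
Unset Strict Implicit.
Unset Printing Implicit Defensive.

(* Digit strings are written most significant digit first. *)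
Definition digit_value (beta : nat) (s : seq nat) : nat :=
  foldl (fun n d => n * beta + d) 0 s.

(* The empty string is excluded: its head is the default 0. *)
Definition canonical_repr (beta n : nat) (s : seq nat) : Prop :=
  [/\ all (fun d => d < beta) s, head 0 s != 0 & digit_value beta s = n].

(* The string s is unique by canonical_repr_unique below. *)
Definition reversed_sum_product_pair (beta a b : nat) : Prop :=
  [/\ 0 < a, a <= b
    & exists s : seq nat,
        canonical_repr beta (a + b) s /\ canonical_repr beta (a * b) (rev s)].

Lemma digit_value_rcons (beta : nat) (s : seq nat) (d : nat) :
  digit_value beta (rcons s d) = digit_value beta s * beta + d.
Proof. by rewrite /digit_value foldl_rcons. Qed.

Lemma canonical_repr_exists (beta n : nat) :
  1 < beta -> 0 < n -> exists s, canonical_repr beta n s.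
Proof.
move=> b1; have b0 : 0 < beta by apply: ltnW.
elim/ltn_ind: n => n IH n0.
have [nb|bn] := ltnP n beta.
  by exists [:: n]; split; rewrite /= ?nb // -lt0n.
have q0 : 0 < n %/ beta by rewrite divn_gt0.
have [s [sb sh sv]] := IH _ (ltn_Pdiv b1 n0) q0.
exists (rcons s (n %% beta)); split.
- by rewrite all_rcons ltn_mod b0 sb.
- by case: s sh {sb sv}.
- by rewrite digit_value_rcons sv -divn_eq.
Qed.

Lemma digit_value_gt0 (beta : nat) (s : seq nat) :
  0 < beta -> head 0 s != 0 -> 0 < digit_value beta s.
Proof.
move=> b0; elim/last_ind: s => [|s d IH] // h.
rewrite digit_value_rcons; case: s IH h => [|x s] IH h.
  by rewrite /digit_value /= mul0n add0n lt0n.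
by rewrite addn_gt0 muln_gt0 b0 IH.
Qed.

Lemma canonical_repr_unique (beta n : nat) (s t : seq nat) :
  1 < beta -> canonical_repr beta n s -> canonical_repr beta n t -> s = t.
Proof.
move=> b1; have b0 : 0 < beta by apply: ltnW.
elim/last_ind: s n t => [|s d IH] n t; first by case.
case=> sb sh sv; elim/last_ind: t => [|t e _]; first by case.
case=> tb th tv; move: sb tb; rewrite !all_rcons => /andP[db sb] /andP[eb tb].
move: sv tv; rewrite !digit_value_rcons => sv tv.
have de : d = e.
  by rewrite -(modn_small db) -(modn_small eb) -(modnMDl (digit_value beta s))
             -(modnMDl (digit_value beta t) e) sv tv.
have hv : digit_value beta s = digit_value beta t.
  by apply/eqP; rewrite -(eqn_pmul2r b0) -(eqn_add2r d) {2}de sv tv.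
rewrite -de; congr rcons.
case: s t IH sh th sb tb hv {sv tv} => [|x s] [|y t] IH sh th sb tb hv //.
- by have := digit_value_gt0 b0 (s := y :: t) th; rewrite -hv.
- by have := digit_value_gt0 b0 (s := x :: s) sh; rewrite hv.
- by apply: (IH (digit_value beta (y :: t))).
Qed.

(* Main.v *)
(* If N = a + b has n digits then ab < 10^n <= 10 (a + b) <= 20 b, so a < 20.
   The reversal R of N satisfies R + a^2 = a N; comparing the outermost digits
   of both sides leaves, from three digits on, only N = 4...9 with a = 2 and
   N = 2...7 with a = 3.  In the first case the equation propagates inwards and
   forces every inner digit to be 9; in the second the next pair of digits is
   contradictory. *)
Require Import Defs.
From mathcomp Require Import all_boot.
From mathcomp Require Import zify.

Lemma digit_value_cons (beta d : nat) (s : seq nat) :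
  digit_value beta (d :: s) = d * beta ^ size s + digit_value beta s.
Proof.
elim/last_ind: s => [|s e IH]; first by rewrite /digit_value /= muln1 addn0.
rewrite -rcons_cons !digit_value_rcons IH size_rcons expnSr.
by rewrite mulnDl mulnA addnA.
Qed.

Lemma digit_value_lt (beta : nat) (s : seq nat) :
  all (fun d => d < beta) s -> digit_value beta s < beta ^ size s.
Proof.
elim: s => [|d s IH] //= /andP[db sb].
rewrite digit_value_cons expnS.
have := IH sb; have : d.+1 * beta ^ size s <= beta * beta ^ size s.
  by rewrite leq_mul2r db orbT.
rewrite mulSn; lia.
Qed.

Lemma digit_value_nseq9 (k : nat) : digit_value 10 (nseq k 9) = 10 ^ k - 1.
Proof.
elim: k => [|k IH] //=.
rewrite digit_value_cons size_nseq IH expnS.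
have : 0 < 10 ^ k by rewrite expn_gt0.
lia.
Qed.

(** Reversal swaps the first and last digits, so strings are peeled from both ends at once. *)
Lemma seq_ends (T : Type) (s : seq T) :
  [\/ s = [::], exists d, s = [:: d] | exists d t e, s = d :: rcons t e].
Proof.
case: s => [|d s]; first by constructor 1.
case/lastP: s => [|t e]; first by constructor 2; exists d.
by constructor 3; exists d, t, e.
Qed.

Lemma digit_value_ends (beta d e : nat) (t : seq nat) :
  digit_value beta (d :: rcons t e) =
  d * (beta * beta ^ size t) + (digit_value beta t * beta + e).
Proof. by rewrite digit_value_cons digit_value_rcons size_rcons expnS. Qed.

Lemma rev_ends (T : Type) (d e : T) (t : seq T) :
  rev (d :: rcons t e) = e :: rcons (rev t) d.
Proof. by rewrite rev_cons rev_rcons rcons_cons. Qed.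

(** Consisting of zeros is invariant under reversal, so value 0 passes from a string to its
    reversal. *)
Lemma digit_value_eq0 (beta : nat) (s : seq nat) :
  0 < beta -> (digit_value beta s == 0) = all (pred1 0) s.
Proof.
move=> b0; elim: s => [|d s IH] //=.
rewrite digit_value_cons addn_eq0 muln_eq0 expn_eq0 IH.
by case: beta b0 {IH} => [|beta] _ //; rewrite orbF.
Qed.

(** Here [m] and [m'] are the values of the inner string and its reversal, and [P] is 10 to its
    length. The condition on [m = 0] excludes a = 9, d = 1, e = 8: there P + 9m = m' + 1, so m = 0
    and m' = P - 1. *)
Lemma outer_digits (a d e m m' P : nat) :
  0 < a < 20 -> 0 < d < 10 -> 0 < e < 10 -> m < P -> m' < P -> 10 <= P ->
  (m = 0 -> m' = 0) ->
  a * (d * (10 * P) + (m * 10 + e)) = e * (10 * P) + (m' * 10 + d) + a * a ->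
  (a, d, e) = (2, 4, 9) \/ (a, d, e) = (3, 2, 7).
Proof.
move=> a20 d10 e10 mP m'P P10 m0 E.
(* Once [a], [d], [e] are numerals, the equation is linear in [m], [m'], [P]. *)
have ha : a \in iota 1 19 by rewrite mem_iota; lia.
have hd : d \in iota 1 9 by rewrite mem_iota; lia.
have he : e \in iota 1 9 by rewrite mem_iota; lia.
move: ha; rewrite !inE.
do ![case/orP] => /eqP ?; subst a.
all: try lia.
all: move: hd; rewrite !inE.
all: do ![case/orP] => /eqP ?; subst d.
all: try lia.
all: move: he; rewrite !inE.
all: do ![case/orP] => /eqP ?; subst e.
all: try lia.
all: by [left | right].
Qed.

Lemma two_digits (a b d e : nat) :
  0 < a < 20 -> a <= b -> 0 < d < 10 -> e < 10 ->
  d * 10 + e = a + b -> e * 10 + d = a * b ->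
  [\/ (a, b) = (9, 9), (a, b) = (3, 24) | (a, b) = (2, 47)].
Proof.
move=> a20 ab d10 e10 E1 E2.
(* Eliminating [b] makes the product equation linear in the digits for each fixed [a]. *)
have eb : b = d * 10 + e - a by lia.
have ha : a \in iota 1 19 by rewrite mem_iota; lia.
have hd : d \in iota 1 9 by rewrite mem_iota; lia.
move: ha; rewrite !inE.
do ![case/orP] => /eqP ?; subst a.
all: try lia.
all: move: hd; rewrite !inE.
all: do ![case/orP] => /eqP ?; subst d.
all: try lia.
all: have he : e \in iota 0 10 by rewrite mem_iota; lia.
all: move: he; rewrite !inE.
all: do ![case/orP] => /eqP ?; subst e.
all: try lia.
all: subst b; by [constructor 1 | constructor 2 | constructor 3].
Qed.

(* In terms of the nines' complement M of t this reads 2 M = rev M, so that the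
   claim is M = 0. *)
Lemma inner_nines (t : seq nat) :
  all (fun d => d < 10) t ->
  2 * digit_value 10 t + 1 = 10 ^ size t + digit_value 10 (rev t) ->
  digit_value 10 t + 1 = 10 ^ size t.
Proof.
have [n] := ubnP (size t); elim: n t => // n IH t.
case: (seq_ends _ t) => [-> //|[d ->]|[d [u [e ->]]]].
  by rewrite /digit_value /=; lia.
rewrite /= size_rcons => nu; rewrite all_rcons => /and3P[d10 e10 u10].
have := digit_value_lt _ _ u10.
have : all (fun d => d < 10) (rev u) by rewrite all_rev.
move/digit_value_lt; rewrite size_rev.
rewrite rev_ends !digit_value_ends !expnS size_rev.
have := IH u _ u10; move: (digit_value 10 u) (digit_value 10 (rev u)) => m m'.
move: (10 ^ size u) => P IHu m'P mP E.
(* Put x = 9 - d, y = 9 - e. The units of 2 M = rev M give 2y = x mod 10, the leading digits y = 2x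
   or 2x + 1; hence x = y = 0. *)
have [d9 e9] : d = 9 /\ e = 9.
{ have hd : d \in iota 0 10 by rewrite mem_iota; lia.
  have he : e \in iota 0 10 by rewrite mem_iota; lia.
  move: hd; rewrite !inE.
  do ![case/orP] => /eqP ?; subst d; try lia.
  all: move: he; rewrite !inE.
  all: do ![case/orP] => /eqP ?; subst e; lia. }
(* Cancelling the two nines leaves the same equation for [u]. *)
by subst d e; have := IHu ltac:(lia) ltac:(lia); lia.
Qed.

(** With T, T' the values of [t] and [rev t], the equality would say 3T + 1 = 10^(size t) + T'. For
    a single digit c this is 2c = 9. For end digits c, y, the units give 3y + 1 = c mod 10 and the
    leading digits 3c + k = 10 + y with a carry k < 3. So 8c + 3k = 9 mod 10, whence k = 1 and c is
    2 or 7, making y = -3 or 12. *)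
Lemma no_inner_digits_3_2_7 (t : seq nat) :
  all (fun d => d < 10) t -> 0 < size t ->
  3 * (2 * (10 * 10 ^ size t) + (digit_value 10 t * 10 + 7)) <>
  7 * (10 * 10 ^ size t) + (digit_value 10 (rev t) * 10 + 2) + 3 * 3.
Proof.
case: (seq_ends _ t) => [-> //|[c ->]|[c [u [y ->]]]].
  by rewrite /digit_value /=; lia.
rewrite /= size_rcons all_rcons => /and3P[c10 y10 u10] _.
have := digit_value_lt _ _ u10.
have : all (fun d => d < 10) (rev u) by rewrite all_rev.
move/digit_value_lt; rewrite size_rev.
rewrite rev_ends !digit_value_ends !expnS size_rev.
move: (digit_value 10 u) (digit_value 10 (rev u)) => m m'.
move: (10 ^ size u) => P m'P mP E.
have hc : c \in iota 0 10 by rewrite mem_iota; lia.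
have hy : y \in iota 0 10 by rewrite mem_iota; lia.
move: hc; rewrite !inE.
do ![case/orP] => /eqP ?; subst c; try lia.
all: move: hy; rewrite !inE.
all: do ![case/orP] => /eqP ?; subst y; lia.
Qed.

Lemma reversed_sum_product_pair_lt20 (a b : nat) :
  reversed_sum_product_pair 10 a b -> a < 20.
Proof.
case=> a0 ab [s [[s10 s0 sv] [r10 r0 rv]]].
have := digit_value_lt _ _ r10; rewrite size_rev rv.
case: s s10 s0 sv {r10 r0 rv} => // d s _ /= d0.
rewrite digit_value_cons expnS.
have : 10 ^ size s <= d * 10 ^ size s by rewrite leq_pmull // lt0n.
move: (10 ^ size s) (d * _) => P dP; nia.
Qed.

Lemma reversed_sum_product_pair_10 (a b : nat) :
  reversed_sum_product_pair 10 a b ->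
  [\/ (a, b) = (2, 2), (a, b) = (9, 9), (a, b) = (3, 24)
    | exists k, 1 <= k /\ (a, b) = (2, 5 * 10 ^ k - 3)].
Proof.
move=> pab; have := reversed_sum_product_pair_lt20 _ _ pab.
case: pab => a0 ab [s [[s10 s0 sv] [_ r0 rv]]] a20.
case: (seq_ends _ s) s10 s0 sv r0 rv => [-> //|[d ->]|[d [t [e ->]]]].
  rewrite /digit_value /= add0n => _ _ -> _ E; constructor 1.
  (* A single digit is its own reversal, so ab = a + b <= 2b. *)
  have [a1 | a2] : a = 1 \/ a = 2 by nia.
    by lia.
  by congr (_, _); lia.
rewrite rev_ends !digit_value_ends /= all_rcons size_rev.
move=> /and3P[d10 e10 t10] d0 E1 e0 E2.
have {}d10 : 0 < d < 10 by rewrite lt0n d0.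
have {}e10 : 0 < e < 10 by rewrite lt0n e0.
have [/size0nil t0 | tpos] := posnP (size t).
  move: E1 E2; rewrite t0 /digit_value /= add0n => E1 E2.
  case: (two_digits a b d e) => //; first by rewrite a0.
  - by case/andP: e10.
  - by constructor 2.
  - by constructor 3.
  - by constructor 4; exists 1.
have r10 : all (fun d => d < 10) (rev t) by rewrite all_rev.
have mP := digit_value_lt _ _ t10.
have := digit_value_lt _ _ r10; rewrite size_rev => m'P.
have P10 : 10 <= 10 ^ size t by rewrite -{1}(expn1 10) leq_exp2l.
have m0 : digit_value 10 t = 0 -> digit_value 10 (rev t) = 0.
  by move/eqP => m0; apply/eqP; rewrite digit_value_eq0 // all_rev -(digit_value_eq0 10).
have E : a * (d * (10 * 10 ^ size t) + (digit_value 10 t * 10 + e)) =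
    e * (10 * 10 ^ size t) + (digit_value 10 (rev t) * 10 + d) + a * a.
  by rewrite E1 E2 mulnDr addnC.
case: (outer_digits _ _ _ _ _ _ _ d10 e10 mP m'P P10 m0 E); first by rewrite a0.
(* The sum is 4 followed by [(size t).+1] nines, the last of them being [e]. *)
- case=> ? ? ?; subst a d e; constructor 4; exists (size t).+1; split=> //.
  have nines : digit_value 10 t + 1 = 10 ^ size t by apply: inner_nines => //; lia.
  by congr (_, _); rewrite expnS; lia.
- by case=> ? ? ?; subst a d e; case: (no_inner_digits_3_2_7 t t10 tpos E).
Qed.

Theorem theorem1p1 (a b : nat) (ha : 0 < a) (hab : a <= b) :
  reversed_sum_product_pair 10 a b <->
  (a, b) \in [:: (2, 2); (9, 9); (3, 24)] \/
  (exists k : nat, 1 <= k /\ (a, b) = (2, 5 * 10 ^ k - 3)).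
Proof.
split.
  by case/reversed_sum_product_pair_10 => [->|->|->|?]; [left|left|left|right].
case.
  rewrite !inE => /or3P[] /eqP[-> ->]; split=> //.
  - by exists [:: 4].
  - by exists [:: 1; 8].
  - by exists [:: 2; 7].
(* The sum 5 * 10^k - 1 is 4 followed by k nines; the product 10^(k+1) - 6 is k nines followed by
   4. *)
case=> k [k1 [ea eb]]; split=> //; exists (4 :: nseq k 9); subst a b.
have k10 : 10 <= 10 ^ k by rewrite -{1}(expn1 10) leq_exp2l.
have n10 : all (fun d => d < 10) (nseq k 9) by rewrite all_nseq orbT.
have nv := digit_value_nseq9 k.
split; split=> //.
- by rewrite digit_value_cons size_nseq nv; lia.
- by rewrite all_rev.
- by rewrite rev_cons rev_nseq; case: k k1 {hab k10 n10 nv}.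
- by rewrite rev_cons rev_nseq digit_value_rcons nv; lia.
Qed.
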